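(* In the setting described in the context, let $n\ge0$ and assume that the given state $\{\mathsf U_i^n\}_{i\in\mathcal V}\subset\mathcal A$ is at rest. Then, under the time-step restriction $\tau\le\min_{i\in\mathcal V}\frac{m_i}{2|d_{ii}^{L,n}|}$, the convex-limited update $$\mathsf U_i^{n+1}=\mathsf U_i^{L,n+1}+\sum_{j\in\mathcal I^*(i)}\ell_{ij}^n\lambda_i\mathsf P_{ij}^n$$ with the limiting coefficients $\ell_{ij}^n=\min(\ell_j^{i,v},\ell_i^{j,v})$ is at rest. (That is, the scheme is well-balanced with respect to rest states.)
   Context: Setting: approximation of the shallow water equations (no external sources) in dimension $d\in\{1,2\}$ with forward Euler time stepping and convex limiting. States and flux. $\mathcal A=\{(h,q)^T\in\mathbb R^{d+1}: h>0\}$. Linear maps $\mathsf H:\mathbb R^{d+1}\to\mathbb R$ and $\mathsf Q:\mathbb R^{d+1}\to\mathbb R^d$ extract depth and discharge of a state $(h,q)^T$. $g>0$ is the gravity constant. The flux is $\mathbb f(u)=(q,\ q\otimes v+\frac12 g h^2 I_d)^T$ with $v=q/h$, so for $c\in\mathbb R^d$: $\mathbb f(u)c=(q\cdot c,\ (v\cdot c)q+\frac12 gh^2c)^T$ (zero if $h=0$, $q=0$). $E_{\rm flat}(u)=\frac12gh^2+\frac12h\|v\|^2$, $F_{\rm flat}(u)=v(E_{\rm flat}(u)+\frac12gh^2)$. Discretization. $\mathcal V=\{1,\dots,I\}$ indexes the degrees of freedom; for each $i\in\mathcal V$, $\mathcal I(i)\subsetneq\mathcal V$ is the stencil at $i$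 (containing $i$), and $\mathcal I^*(i)=\mathcal I(i)\setminus\{i\}$. Given are: masses $m_i>0$; an invertible symmetric matrix $(m_{ij})$ with $m_i=\sum_{j\in\mathcal I(i)}m_{ij}$; vectors $c_{ij}\in\mathbb R^d$ with $\sum_{j\in\mathcal I(i)}c_{ij}=0$ and $c_{ij}=-c_{ji}$ whenever $i$ or $j$ is not a boundary degree of freedom; $c_{ij}=0$ and $m_{ij}=0$ if $j\notin\mathcal I(i)$. The topography is given by real numbers $\mathsf Z_i$. The state at time $t^n$ is $\mathsf U_i^n=(\mathsf H_i^n,\mathsf Q_i^n)^T\in\mathbb R^{d+1}$; $\tau>0$ is the time step. Velocity. With a small parameter $\epsilon>0$ and a depth scale $h_{\max}>0$, the regularized velocity of a state $\mathsf U$ is $\mathsf V(\mathsf U)=\frac{2\mathsf H(\mathsf U)}{\mathsf H(\mathsf U)^2+\max(\mathsf H(\mathsf U),\epsilon h_{\max})^2}\mathsf Q(\mathsf U)$, and $\mathsf V_i^n=\mathsf V(\mathsf U_i^n)$. Hydrostatic reconstruction. $\mathsf H_i^{*,j}=\max(0,\mathsf H_i^n+\mathsf Z_i-\max(\mathsf Z_i,\mathsf Z_j))$, $\mathsf U_i^{*,j}=(\mathsf H_i^{*,j},\mathsf H_i^{*,j}\mathsf V_i^n)^T$. Rest states. A set of states $\{(\mathsf H_i,\mathsf Q_i)\}_{i\in\mathcal V}$ is at rest if $\mathsf Q_i=0$ for all $i\in\mathcal V$ and $\mathsf H_i^{*,j}=\mathsf H_j^{*,i}$ for all $i\in\mathcal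 V$ and $j\in\mathcal I(i)$, where $\mathsf H_i^{*,j}=\max(0,\mathsf H_i+\mathsf Z_i-\max(\mathsf Z_i,\mathsf Z_j))$. Low-order graph viscosity. For $j\in\mathcal I^*(i)$, $d_{ij}^{L,n}=\max\big(\lambda_{\max}(\mathsf U_i^{*,j},\mathsf U_j^{*,i},n_{ij})\|c_{ij}\|_{\ell^2},\ \lambda_{\max}(\mathsf U_j^{*,i},\mathsf U_i^{*,j},n_{ji})\|c_{ji}\|_{\ell^2}\big)$, where $n_{ij}=c_{ij}/\|c_{ij}\|_{\ell^2}$ and $\lambda_{\max}(\mathsf U_\ell,\mathsf U_r,n)$ is a guaranteed upper bound on the maximum wave speed in the one-dimensional Riemann problem with left state $\mathsf U_\ell$, right state $\mathsf U_r$ and flux $\mathbb f(\cdot)n$. Also $d_{ii}^{L,n}=-\sum_{j\in\mathcal I^*(i)}d_{ij}^{L,n}$. Low-order update. $\frac{m_i}{\tau}(\mathsf U_i^{L,n+1}-\mathsf U_i^n)=\sum_{j\in\mathcal I(i)}\mathsf F_{ij}^{L,n}$ with $$\mathsf F_{ij}^{L,n}=-\big(\mathsf U_j^{*,i}\otimes\mathsf V_j^n+\mathsf U_i^{*,j}\otimes\mathsf V_i^n\big)c_{ij}+d_{ij}^{L,n}(\mathsf U_j^{*,i}-\mathsf U_i^{*,j})-\begin{pmatrix}0\\ g\,c_{ij}\big(\tfrac12(\mathsf H_j^{*,i})^2-\tfrac12(\mathsf H_i^{*,j})^2+(\mathsf H_i^n)^2\big)\end{pmatrix}.$$ High-order flux.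 $$\mathsf F_{ij}^{H,n}=-\big(\mathsf U_j^n\otimes\mathsf V_j^n+\mathsf U_i^n\otimes\mathsf V_i^n\big)c_{ij}+d_{ij}^{H,n}(\mathsf U_j^{*,i}-\mathsf U_i^{*,j})-\begin{pmatrix}0\\ g\big(\mathsf H_i^n\mathsf H_j^n+\mathsf H_i^n(\mathsf Z_j-\mathsf Z_i)\big)c_{ij}\end{pmatrix},\qquad \mathsf F_i^{H,n}=\sum_{j\in\mathcal I(i)}\mathsf F_{ij}^{H,n},$$ with $d_{ij}^{H,n}=d_{ij}^{L,n}\frac{\alpha_i^n+\alpha_j^n}{2}$ for $i\ne j$ (the value for $i=j$ multiplies zero), where $\alpha_i^n=\frac{|N_i^n|}{D_i^n+\epsilon D_{\max}}\in[0,1]$, $D_{\max}=\sqrt{gh_{\max}}\,\frac12gh_{\max}^2$, $N_i^n=\sum_{j\in\mathcal I(i)}\{F_{\rm flat}(\mathsf U_j^n)\cdot c_{ij}-\nabla_uE_{\rm flat}(\mathsf U_i^n)^T\mathbb f(\mathsf U_j^n)c_{ij}\}$, $D_i^n=|\sum_{j\in\mathcal I(i)}F_{\rm flat}(\mathsf U_j^n)\cdot c_{ij}|+|\sum_{j\in\mathcal I(i)}\nabla_uE_{\rm flat}(\mathsf U_i^n)^T\mathbb f(\mathsf U_j^n)c_{ij}|$. Corrections. $\lambda_i=1/\mathrm{Card}(\mathcal I^*(i))$, $b_{ij}=\delta_{ij}-m_{ij}/m_j$, $\mathsf P_{ij}^n=\frac{\tau}{m_i\lambda_i}\{\mathsf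 F_{ij}^{H,n}-\mathsf F_{ij}^{L,n}+b_{ij}\mathsf F_j^{H,n}-b_{ji}\mathsf F_i^{H,n}\}$; write $\mathsf P_{ij}^n=(\mathsf P_{ij}^h,\mathsf P_{ij}^q)^T$. Auxiliary states and local bounds. For $j\in\mathcal I^*(i)$, $\overline{\mathsf U}_{ij}^n=\frac12(\mathsf U_i^{*,j}+\mathsf U_j^{*,i})-\frac{1}{2d_{ij}^{L,n}}\big(\mathbb f(\mathsf U_j^{*,i})-\mathbb f(\mathsf U_i^{*,j})\big)c_{ij}$, and $\overline{\mathsf U}_{ii}^n=\mathsf U_i^n$. $\mathsf B_i^{L,n}=\sum_{j\in\mathcal I(i)}-2(d_{ij}^{L,n}+\mathsf V_i^n\cdot c_{ij})(\mathsf U_i^{*,j}-\mathsf U_i^n)$. $\overline{\mathsf W}_{ij}^n=\overline{\mathsf U}_{ij}^n+\frac{\tau}{m_i}\mathsf B_i^{L,n}$; $\mathsf H_{i,\min}^n$, $\mathsf H_{i,\max}^n$ are the min and max of $\mathsf H(\overline{\mathsf W}_{ij}^n)$ over $j\in\mathcal I(i)$; $\mathsf V_{i,\max}^{2,n}=\max_{j\in\mathcal I(i)}\|\mathsf V(\overline{\mathsf W}_{ij}^n)\|_{\ell^2}^2$. Limiter. With $\mathsf H_i^{L}=\mathsf H(\mathsf U_i^{L,n+1})$: $\ell_j^{i,h}=\min\big(\frac{|\mathsf H_{i,\min}^n-\mathsf H_i^L|}{|\mathsf P_{ij}^h|+\epsilon\mathsf H_{i,\max}^n},1\big)$ if $\mathsf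 H_i^L+\mathsf P_{ij}^h<\mathsf H_{i,\min}^n$; $\ell_j^{i,h}=1$ if $\mathsf H_{i,\min}^n\le\mathsf H_i^L+\mathsf P_{ij}^h\le\mathsf H_{i,\max}^n$; $\ell_j^{i,h}=\min\big(\frac{|\mathsf H_{i,\max}^n-\mathsf H_i^L|}{|\mathsf P_{ij}^h|+\epsilon\mathsf H_{i,\max}^n},1\big)$ if $\mathsf H_{i,\max}^n<\mathsf H_i^L+\mathsf P_{ij}^h$. Let $\Psi_3(\mathsf U)=\mathsf H(\mathsf U)^2\mathsf V_{i,\max}^{2,n}-\|\mathsf Q(\mathsf U)\|_{\ell^2}^2$. Then $\ell_j^{i,v}\in[0,\ell_j^{i,h}]$ is the largest number such that $\Psi_3(\mathsf U_i^{L,n+1}+\ell\,\mathsf P_{ij}^n)\ge0$ for all $\ell\in[0,\ell_j^{i,v}]$ (taken to be $0$ if there is none). Finally $\ell_{ij}^n=\min(\ell_j^{i,v},\ell_i^{j,v})$. *)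

(* Defs.v *)
From HB Require Import structures.
From mathcomp Require Export all_boot all_order all_algebra.
From mathcomp Require Export all_classical all_reals all_analysis.
Export Order.TTheory GRing.Theory Num.Theory.
Export numFieldNormedType.Exports.

Set Implicit Arguments.
Unset Strict Implicit.
Unset Printing Implicit Defensive.

Local Open Scope classical_set_scope.
Local Open Scope ring_scope.

(** ** Euclidean vectors *)

Definition dot (R : realType) (k : nat) (a b : 'cV[R]_k) : R :=
  \sum_i a i 0 * b i 0.

(* The library norm of a matrix is the sup norm, hence a separate l2 norm. *)
Definition l2norm (R : realType) (k : nat) (a : 'cV[R]_k) : R :=
  Num.sqrt (dot a a).

Definition tensor (R : realType) (k l : nat) (a : 'cV[R]_k) (b : 'cV[R]_l)
  : 'M[R]_(k, l) := a *m b^T.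

Definition gradient (R : realType) (k : nat) (f : 'cV[R]_k -> R)
  (u : 'cV[R]_k) : 'cV[R]_k := \col_i 'D_(delta_mx i 0) f u.

(** ** States, flux, energy pair of the shallow water equations *)

Notation state R d := 'cV[R]_(1 + d).

Definition mkstate (R : realType) (d : nat) (h : R) (q : 'cV[R]_d)
  : state R d := col_mx h%:M q.

Definition depth (R : realType) (d : nat) (u : state R d) : R :=
  usubmx u 0 0.

Definition discharge (R : realType) (d : nat) (u : state R d) : 'cV[R]_d :=
  dsubmx u.

Definition wet (R : realType) (d : nat) (u : state R d) : Prop := 0 < depth u.

(* Since 0^-1 = 0, the velocity, hence the flux and the energy pair, vanish
   at the dry state u = 0. *)
Definition velocity (R : realType) (d : nat) (u : state R d) : 'cV[R]_d :=
  (depth u)^-1 *: discharge u.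

Definition flux (R : realType) (d : nat) (g : R) (u : state R d)
  : 'M[R]_(1 + d, d) :=
  col_mx (discharge u)^T
         (tensor (discharge u) (velocity u) + (2^-1 * g * depth u ^+ 2)%:M).

Definition Eflat (R : realType) (d : nat) (g : R) (u : state R d) : R :=
  2^-1 * g * depth u ^+ 2 + 2^-1 * depth u * l2norm (velocity u) ^+ 2.

Definition Fflat (R : realType) (d : nat) (g : R) (u : state R d)
  : 'cV[R]_d :=
  (Eflat g u + 2^-1 * g * depth u ^+ 2) *: velocity u.

(** ** Riemann problems and bounds on their wave speeds *)

Definition wet_or_dry (R : realType) (d : nat) (u : state R d) : Prop :=
  wet u \/ u = 0.

(* [riemann_solution g n ul ur w s]: the function (x, t) |-> w (x / t) is the
   self-similar entropy solution of
     d_t u + d_x (f(u) n) = 0,  u(x, 0) = ul if x < 0, ur if x > 0,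
   with w of class C^1 away from the finite list s of speeds.
   In the variable xi = x / t the equation reads (f(w) n)' = xi w'; at a speed
   a of s it is the Rankine-Hugoniot relation, and the entropy inequality
   d_t E + d_x (F . n) <= 0 becomes [F . n] <= a [E].  Right-continuity at the
   points of s only fixes the representative of w. *)
Record riemann_solution (R : realType) (d : nat) (g : R) (n : 'cV[R]_d)
    (ul ur : state R d) (w : R -> state R d) (s : seq R) : Prop := {
  rs_states : forall xi, wet_or_dry (w xi);
  rs_left : \forall xi \near -oo, w xi = ul;
  rs_right : \forall xi \near +oo, w xi = ur;
  rs_smooth : forall xi, xi \notin s ->
    [/\ derivable w xi 1,
        {for xi, continuous (derive1 w)} &
        is_derive xi 1 (fun x => flux g (w x) *m n) (xi *: derive1 w xi)];
  rs_jump : forall a, a \in s -> exists wm : state R d,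
    [/\ w @ a^'- --> wm, w @ a^'+ --> w a, wet_or_dry wm,
        flux g (w a) *m n - flux g wm *m n = a *: (w a - wm) &
        dot (Fflat g (w a)) n - dot (Fflat g wm) n
          <= a * (Eflat g (w a) - Eflat g wm)]
}.

Definition wave_speed_bound (R : realType) (d : nat) (g : R) (n : 'cV[R]_d)
    (ul ur : state R d) (L : R) : Prop :=
  0 <= L /\
  forall w s, riemann_solution g n ul ur w s ->
    (forall xi, xi < - L -> w xi = ul) /\ (forall xi, L < xi -> w xi = ur).

(** ** Data of the discretization *)

(* The degrees of freedom are indexed by 'I_N; [bdry] is the set of boundary
   ones. *)
Record setting (R : realType) (d N : nat) := Setting {
  grav : R;
  eps : R;
  hmax : R;
  lam_max : state R d -> state R d -> 'cV[R]_d -> R;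
  stencil : 'I_N -> {set 'I_N};
  bdry : {set 'I_N};
  mass : 'I_N -> R;
  mass_mx : 'M[R]_N;
  cc : 'I_N -> 'I_N -> 'cV[R]_d;
  topo : 'I_N -> R;
  grav_gt0 : 0 < grav;
  eps_gt0 : 0 < eps;
  hmax_gt0 : 0 < hmax;
  lam_maxP : forall (ul ur : state R d) (n : 'cV[R]_d),
    wet_or_dry ul -> wet_or_dry ur -> l2norm n = 1 ->
    wave_speed_bound grav n ul ur (lam_max ul ur n);
  stencil_proper : forall i, stencil i \proper [set: 'I_N];
  stencil_refl : forall i, i \in stencil i;
  mass_gt0 : forall i, 0 < mass i;
  mass_mx_unit : mass_mx \in unitmx;
  mass_mx_sym : mass_mx^T = mass_mx;
  mass_lumped : forall i, mass i = \sum_(j in stencil i) mass_mx i j;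
  mass_mx_out : forall i j, j \notin stencil i -> mass_mx i j = 0;
  cc_sum0 : forall i, \sum_(j in stencil i) cc i j = 0;
  cc_anti : forall i j, i \notin bdry \/ j \notin bdry -> cc i j = - cc j i;
  cc_out : forall i j, j \notin stencil i -> cc i j = 0
}.

Definition stencil_star (R : realType) (d N : nat) (S : setting R d N)
  (i : 'I_N) : {set 'I_N} := stencil S i :\ i.

(** ** Hydrostatic reconstruction and rest states *)

Definition reg_velocity (R : realType) (d N : nat) (S : setting R d N)
    (u : state R d) : 'cV[R]_d :=
  (2 * depth u
    / (depth u ^+ 2 + Num.max (depth u) (eps S * hmax S) ^+ 2))
  *: discharge u.

Definition Hstar (R : realType) (d N : nat) (S : setting R d N)
    (U : 'I_N -> state R d) (i j : 'I_N) : R :=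
  Num.max 0 (depth (U i) + topo S i - Num.max (topo S i) (topo S j)).

Definition Ustar (R : realType) (d N : nat) (S : setting R d N)
    (U : 'I_N -> state R d) (i j : 'I_N) : state R d :=
  mkstate (Hstar S U i j) (Hstar S U i j *: reg_velocity S (U i)).

Definition at_rest (R : realType) (d N : nat) (S : setting R d N)
    (U : 'I_N -> state R d) : Prop :=
  (forall i, discharge (U i) = 0) /\
  (forall i j, j \in stencil S i -> Hstar S U i j = Hstar S U j i).

(** ** Low-order scheme *)

Definition unit_normal (R : realType) (d N : nat) (S : setting R d N)
  (i j : 'I_N) : 'cV[R]_d := (l2norm (cc S i j))^-1 *: cc S i j.

Definition dL_off (R : realType) (d N : nat) (S : setting R d N)
    (U : 'I_N -> state R d) (i j : 'I_N) : R :=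
  Num.max
    (lam_max S (Ustar S U i j) (Ustar S U j i) (unit_normal S i j)
       * l2norm (cc S i j))
    (lam_max S (Ustar S U j i) (Ustar S U i j) (unit_normal S j i)
       * l2norm (cc S j i)).

Definition dL (R : realType) (d N : nat) (S : setting R d N)
    (U : 'I_N -> state R d) (i j : 'I_N) : R :=
  if i == j then - \sum_(k in stencil_star S i) dL_off S U i k
  else dL_off S U i j.

Definition FL (R : realType) (d N : nat) (S : setting R d N)
    (U : 'I_N -> state R d) (i j : 'I_N) : state R d :=
  - ((tensor (Ustar S U j i) (reg_velocity S (U j))
      + tensor (Ustar S U i j) (reg_velocity S (U i))) *m cc S i j)
  + dL S U i j *: (Ustar S U j i - Ustar S U i j)
  - mkstate 0
      ((grav S * (2^-1 * Hstar S U j i ^+ 2 - 2^-1 * Hstar S U i j ^+ 2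
                  + depth (U i) ^+ 2)) *: cc S i j).

Definition low_order_update (R : realType) (d N : nat) (S : setting R d N)
    (tau : R) (U : 'I_N -> state R d) (i : 'I_N) : state R d :=
  U i + (tau / mass S i) *: \sum_(j in stencil S i) FL S U i j.

(** ** High-order fluxes *)

Definition entropy_N (R : realType) (d N : nat) (S : setting R d N)
    (U : 'I_N -> state R d) (i : 'I_N) : R :=
  \sum_(j in stencil S i)
    (dot (Fflat (grav S) (U j)) (cc S i j)
     - dot (gradient (Eflat (grav S)) (U i))
           (flux (grav S) (U j) *m cc S i j)).

Definition entropy_D (R : realType) (d N : nat) (S : setting R d N)
    (U : 'I_N -> state R d) (i : 'I_N) : R :=
  `| \sum_(j in stencil S i) dot (Fflat (grav S) (U j)) (cc S i j) |
  + `| \sum_(j in stencil S i)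
         dot (gradient (Eflat (grav S)) (U i))
             (flux (grav S) (U j) *m cc S i j) |.

Definition Dmax (R : realType) (d N : nat) (S : setting R d N) : R :=
  Num.sqrt (grav S * hmax S) * (2^-1 * grav S * hmax S ^+ 2).

Definition alpha (R : realType) (d N : nat) (S : setting R d N)
    (U : 'I_N -> state R d) (i : 'I_N) : R :=
  `| entropy_N S U i | / (entropy_D S U i + eps S * Dmax S).

(* For i = j the value is irrelevant: it only multiplies zero in [FH]. *)
Definition dH (R : realType) (d N : nat) (S : setting R d N)
    (U : 'I_N -> state R d) (i j : 'I_N) : R :=
  dL S U i j * ((alpha S U i + alpha S U j) / 2).

Definition FH (R : realType) (d N : nat) (S : setting R d N)
    (U : 'I_N -> state R d) (i j : 'I_N) : state R d :=
  - ((tensor (U j) (reg_velocity S (U j))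
      + tensor (U i) (reg_velocity S (U i))) *m cc S i j)
  + dH S U i j *: (Ustar S U j i - Ustar S U i j)
  - mkstate 0
      ((grav S * (depth (U i) * depth (U j)
                  + depth (U i) * (topo S j - topo S i))) *: cc S i j).

Definition FH_sum (R : realType) (d N : nat) (S : setting R d N)
    (U : 'I_N -> state R d) (i : 'I_N) : state R d :=
  \sum_(j in stencil S i) FH S U i j.

Definition lambda (R : realType) (d N : nat) (S : setting R d N) (i : 'I_N)
  : R := (#|stencil_star S i|%:R)^-1.

Definition bcoef (R : realType) (d N : nat) (S : setting R d N)
  (i j : 'I_N) : R := (i == j)%:R - mass_mx S i j / mass S j.

Definition Pcorr (R : realType) (d N : nat) (S : setting R d N) (tau : R)
    (U : 'I_N -> state R d) (i j : 'I_N) : state R d :=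
  (tau / (mass S i * lambda S i)) *:
    (FH S U i j - FL S U i j
     + bcoef S i j *: FH_sum S U j - bcoef S j i *: FH_sum S U i).

(** ** Auxiliary states and local bounds *)

Definition Ubar (R : realType) (d N : nat) (S : setting R d N)
    (U : 'I_N -> state R d) (i j : 'I_N) : state R d :=
  if i == j then U i
  else 2^-1 *: (Ustar S U i j + Ustar S U j i)
       - (2 * dL S U i j)^-1 *:
           ((flux (grav S) (Ustar S U j i) - flux (grav S) (Ustar S U i j))
            *m cc S i j).

Definition BL (R : realType) (d N : nat) (S : setting R d N)
    (U : 'I_N -> state R d) (i : 'I_N) : state R d :=
  \sum_(j in stencil S i)
    (- 2 * (dL S U i j + dot (reg_velocity S (U i)) (cc S i j)))
      *: (Ustar S U i j - U i).

Definition Wbar (R : realType) (d N : nat) (S : setting R d N) (tau : R)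
    (U : 'I_N -> state R d) (i j : 'I_N) : state R d :=
  Ubar S U i j + (tau / mass S i) *: BL S U i.

(* As i belongs to its own stencil, starting the iterated min/max from the
   value at j = i gives the min/max over the stencil. *)
Definition Hmin (R : realType) (d N : nat) (S : setting R d N) (tau : R)
    (U : 'I_N -> state R d) (i : 'I_N) : R :=
  \big[Num.min/depth (Wbar S tau U i i)]_(j in stencil S i)
    depth (Wbar S tau U i j).

Definition Hmax (R : realType) (d N : nat) (S : setting R d N) (tau : R)
    (U : 'I_N -> state R d) (i : 'I_N) : R :=
  \big[Num.max/depth (Wbar S tau U i i)]_(j in stencil S i)
    depth (Wbar S tau U i j).

Definition V2max (R : realType) (d N : nat) (S : setting R d N) (tau : R)
    (U : 'I_N -> state R d) (i : 'I_N) : R :=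
  \big[Num.max/l2norm (reg_velocity S (Wbar S tau U i i)) ^+ 2]_(j in stencil S i)
    l2norm (reg_velocity S (Wbar S tau U i j)) ^+ 2.

(** ** Convex limiting *)

Definition ell_h (R : realType) (d N : nat) (S : setting R d N) (tau : R)
    (U : 'I_N -> state R d) (i j : 'I_N) : R :=
  let HL := depth (low_order_update S tau U i) in
  let Ph := depth (Pcorr S tau U i j) in
  let hmin := Hmin S tau U i in
  let hmax := Hmax S tau U i in
  if HL + Ph < hmin then
    Num.min (`| hmin - HL | / (`| Ph | + eps S * hmax)) 1
  else if HL + Ph <= hmax then 1
  else Num.min (`| hmax - HL | / (`| Ph | + eps S * hmax)) 1.

Definition Psi3 (R : realType) (d N : nat) (S : setting R d N) (tau : R)
    (U : 'I_N -> state R d) (i : 'I_N) (u : state R d) : R :=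
  depth u ^+ 2 * V2max S tau U i - l2norm (discharge u) ^+ 2.

Definition ell_v_admissible (R : realType) (d N : nat) (S : setting R d N)
    (tau : R) (U : 'I_N -> state R d) (i j : 'I_N) : set R :=
  [set r | 0 <= r <= ell_h S tau U i j /\
    forall l, 0 <= l <= r ->
      0 <= Psi3 S tau U i
             (low_order_update S tau U i + l *: Pcorr S tau U i j)].

(* The largest admissible number, and 0 if there is none. *)
Definition ell_v (R : realType) (d N : nat) (S : setting R d N) (tau : R)
    (U : 'I_N -> state R d) (i j : 'I_N) : R :=
  xget 0 [set r | ell_v_admissible S tau U i j r /\
                  ubound (ell_v_admissible S tau U i j) r].

Definition ell (R : realType) (d N : nat) (S : setting R d N) (tau : R)
    (U : 'I_N -> state R d) (i j : 'I_N) : R :=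
  Num.min (ell_v S tau U i j) (ell_v S tau U j i).

Definition limited_update (R : realType) (d N : nat) (S : setting R d N)
    (tau : R) (U : 'I_N -> state R d) (i : 'I_N) : state R d :=
  low_order_update S tau U i
  + \sum_(j in stencil_star S i)
      (ell S tau U i j * lambda S i) *: Pcorr S tau U i j.

(* tau <= min_i m_i / (2 |d_ii|), where m_i / 0 is read as +oo. *)
Definition time_step_restriction (R : realType) (d N : nat)
    (S : setting R d N) (tau : R) (U : 'I_N -> state R d) : Prop :=
  forall i, dL S U i i != 0 -> tau <= mass S i / (2 * `| dL S U i i |).

(* Main.v *)
Require Import Defs.
Local Open Scope ring_scope.

(** At a wet rest state every velocity vanishes and the two reconstructed
    states of each edge coincide, so convection and graph viscosity drop out
    of both fluxes.  What is left is the pressure.  The low-order one is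
    [- g (H_i)^2 c_ij].  Because all depths are positive, equality of the
    reconstructed depths forces [H_i + Z_i = H_j + Z_j] ([rest_free_surface]),
    so the high-order pressure [g H_i (H_j + Z_j - Z_i) c_ij] has the same
    value: [FL_rest] and [FH_rest].  Since the vectors [c_ij] sum to zero over
    each stencil, all these fluxes sum to zero.  Hence the low-order update
    returns the given state and the corrections [P_ij] are zero, so the limited
    update leaves the given state unchanged. *)

Section RestStates.
Variables (R : realType) (d N : nat) (S : setting R d N).
Variable U : 'I_N -> state R d.
Hypotheses (U_wet : forall i, wet (U i)) (U_rest : at_rest S U).

Lemma rest_reg_velocity i : reg_velocity S (U i) = 0.
Proof. by rewrite /reg_velocity (proj1 U_rest) scaler0. Qed.

Lemma rest_Ustar i j : j \in stencil S i -> Ustar S U i j = Ustar S U j i.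
Proof.
by move=> ij; rewrite /Ustar !rest_reg_velocity !scaler0 (proj2 U_rest _ _ ij).
Qed.

(** On the side with the higher bottom the reconstruction keeps the depth,
    which is positive; the other reconstructed depth is therefore positive too,
    so that its cutoff at zero is inactive.  With dry states the cutoff could
    hide a jump of the free surface. *)
Lemma rest_free_surface i j : j \in stencil S i ->
  depth (U i) + topo S i = depth (U j) + topo S j.
Proof.
move=> /(proj2 U_rest i j); rewrite /Hstar (maxC (topo S j)).
have := U_wet i; have := U_wet j; rewrite /wet.
move: (depth (U i)) (depth (U j)) (topo S i) (topo S j) => hi hj zi zj.
move=> hj0 hi0; case: (leP zi zj) => _; rewrite addrK.
- rewrite (max_r (ltW hj0)); case: leP => _ E; last by rewrite E ltxx in hj0.
  by rewrite -E subrK.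
- rewrite (max_r (ltW hi0)); case: leP => _ E; last by rewrite -E ltxx in hi0.
  by rewrite E subrK.
Qed.

Definition rest_flux i j : state R d :=
  - mkstate 0 ((grav S * depth (U i) ^+ 2) *: cc S i j).

Lemma FL_rest i j : j \in stencil S i -> FL S U i j = rest_flux i j.
Proof.
move=> ij; rewrite /FL !rest_reg_velocity /tensor trmx0 !mulmx0 addr0 mul0mx.
by rewrite (rest_Ustar _ _ ij) (proj2 U_rest _ _ ij) !subrr scaler0 oppr0 !add0r.
Qed.

Lemma FH_rest i j : j \in stencil S i -> FH S U i j = rest_flux i j.
Proof.
move=> ij; rewrite /FH !rest_reg_velocity /tensor trmx0 !mulmx0 addr0 mul0mx.
rewrite (rest_Ustar _ _ ij) subrr scaler0 oppr0 !add0r -mulrDr addrA.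
by rewrite -(rest_free_surface _ _ ij) addrK -expr2.
Qed.

Lemma rest_flux_sum i : \sum_(j in stencil S i) rest_flux i j = 0.
Proof.
rewrite /rest_flux.
rewrite sumrN; apply/eqP; rewrite oppr_eq0; apply/eqP.
have -> : \sum_(j in stencil S i)
      mkstate 0 ((grav S * depth (U i) ^+ 2) *: cc S i j) =
    \sum_(j in stencil S i)
      (grav S * depth (U i) ^+ 2) *: mkstate 0 (cc S i j).
  apply: eq_bigr => j _; rewrite /mkstate scale_col_mx.
  by rewrite scale_scalar_mx mulr0.
rewrite -scaler_sumr.
have -> : \sum_(j in stencil S i) mkstate 0 (cc S i j) =
    mkstate 0 (\sum_(j in stencil S i) cc S i j).
  apply: (big_rec2 (fun (u : state R d) q => u = mkstate 0 q)).
    by rewrite /mkstate raddf0 col_mx0.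
  by move=> j u q _ ->; rewrite /mkstate add_col_mx raddf0 addr0.
by rewrite cc_sum0 /mkstate raddf0 col_mx0 scaler0.
Qed.

Lemma FH_sum_rest i : FH_sum S U i = 0.
Proof. by rewrite /FH_sum (eq_bigr _ (FH_rest i)) rest_flux_sum. Qed.

Lemma low_order_update_rest tau i : low_order_update S tau U i = U i.
Proof.
by rewrite /low_order_update (eq_bigr _ (FL_rest i)) rest_flux_sum scaler0 addr0.
Qed.

Lemma Pcorr_rest tau i j : j \in stencil S i -> Pcorr S tau U i j = 0.
Proof.
move=> ij; rewrite /Pcorr !FH_sum_rest (FL_rest _ _ ij) (FH_rest _ _ ij).
by rewrite !scaler0 subrr addr0 subr0 scaler0.
Qed.

Lemma limited_update_rest tau i : limited_update S tau U i = U i.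
Proof.
rewrite /limited_update low_order_update_rest big1 ?addr0 // => j.
by rewrite !inE => /andP[_ ij]; rewrite Pcorr_rest // scaler0.
Qed.

End RestStates.

Theorem proposition3p14 (R : realType) (d N : nat) (hd : d = 1%N \/ d = 2%N)
    (S : setting R d N) (tau : R) (tau_gt0 : 0 < tau)
    (U : nat -> 'I_N -> state R d) (n : nat)
    (U_wet : forall i, wet (U n i))
    (U_rest : at_rest S (U n))
    (U_tau : time_step_restriction S tau (U n))
    (U_next : forall i, U n.+1 i = limited_update S tau (U n) i) :
  at_rest S (U n.+1).
Proof.
suff -> : U n.+1 = U n by [].
by apply/funext => i; rewrite U_next limited_update_rest.
Qed.
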